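(* Let $G$ be a nontrivial connected graph. Then $\mathrm{srd}(G)=2$ if and only if $\mathrm{rd}(G)=2$.
   Context: All graphs are simple, finite and undirected. An edge-coloring of $G$ is any map $c:E(G)\to[k]$ (adjacent edges may receive the same color). For distinct vertices $u,v$ of a connected graph $G$, a $u$-$v$-edge-cut is a set $F$ of edges such that $u$ and $v$ lie in different components of $G-F$; a minimum $u$-$v$-edge-cut is one of minimum size among these. A set of edges is rainbow if no two of its edges have the same color. An edge-colored connected graph is rainbow disconnected if for every two distinct vertices $u,v$ there is a rainbow $u$-$v$-edge-cut; $\mathrm{rd}(G)$ is the smallest number of colors of an edge-coloring making $G$ rainbow disconnected. An edge-colored connected graph is strong rainbow disconnected if for every two distinct vertices $u,v$ there is a $u$-$v$-edge-cut that is both rainbow and minimum; $\mathrm{srd}(G)$ is the smallest number of colors of an edge-coloring making $G$ strong rainbow disconnected. *)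

(* Defs.v *)
From mathcomp Require Import all_boot.

Set Implicit Arguments.
Unset Strict Implicit.
Unset Printing Implicit Defensive.

Record sgraph := SGraph {
  vertex :> finType;
  adj : rel vertex;
  adj_sym : symmetric adj;
  adj_irr : irreflexive adj }.

Section Graph.
Variable G : sgraph.

Definition edges : {set {set G}} :=
  [set [set p.1; p.2] | p : G * G & adj p.1 p.2].

Definition edge : finType := {f : {set G} | f \in edges}.

Definition connected : Prop := forall u v : G, connect (@adj G) u v.

Definition nontrivial : Prop := 1 < #|G|.

(* Adjacency in G - F. *)
Definition adj_del (F : {set edge}) : rel G :=
  fun x y => adj x y && ([set x; y] \notin [set val f | f in F]).

Definition edge_cut (u v : G) (F : {set edge}) : bool :=
  ~~ connect (adj_del F) u v.

Definition min_edge_cut (u v : G) (F : {set edge}) : bool :=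
  edge_cut u v F && [forall F' : {set edge}, edge_cut u v F' ==> (#|F| <= #|F'|)].

Section Coloring.
Variables (k : nat) (c : {ffun edge -> 'I_k}).

Definition rainbow (F : {set edge}) : bool :=
  [forall f in F, forall g in F, (f != g) ==> (c f != c g)].

Definition rainbow_disconnected : bool :=
  [forall u : G, forall v : G, (u != v) ==>
    [exists F : {set edge}, edge_cut u v F && rainbow F]].

Definition strong_rainbow_disconnected : bool :=
  [forall u : G, forall v : G, (u != v) ==>
    [exists F : {set edge}, min_edge_cut u v F && rainbow F]].

End Coloring.

Lemma edge_cut_setT (u v : G) : u != v -> edge_cut u v setT.
Proof.
move=> /eqP uv; apply/negP => /connectP [[|x p] /=]; first by move=> _ /esym.
case/andP=> /andP [ux uxN] _ _.
have xE : [set u; x] \in edges by apply/imsetP; exists (u, x); rewrite ?inE.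
case/negP: uxN; apply/imsetP; by exists (exist (fun f => f \in edges) _ xE : edge); rewrite ?inE.
Qed.

Lemma rainbow_enum_rank (F : {set edge}) :
  rainbow [ffun f : edge => enum_rank f] F.
Proof.
apply/forall_inP => f _; apply/forall_inP => g _.
by apply/implyP; rewrite !ffunE (inj_eq enum_rank_inj).
Qed.

Lemma rd_ex :
  exists k, [exists c : {ffun edge -> 'I_k}, rainbow_disconnected c].
Proof.
exists #|edge|; apply/existsP; exists [ffun f : edge => enum_rank f].
apply/forallP => u; apply/forallP => v; apply/implyP => uv.
by apply/existsP; exists setT; rewrite edge_cut_setT // rainbow_enum_rank.
Qed.

Lemma srd_ex :
  exists k, [exists c : {ffun edge -> 'I_k}, strong_rainbow_disconnected c].
Proof.
exists #|edge|; apply/existsP; exists [ffun f : edge => enum_rank f].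
apply/forallP => u; apply/forallP => v; apply/implyP => uv.
case: (arg_minnP (fun F : {set edge} => #|F|) (edge_cut_setT uv)) => F cF minF.
apply/existsP; exists F; rewrite rainbow_enum_rank andbT /min_edge_cut cF /=.
by apply/forallP => F'; apply/implyP => /minF.
Qed.

(* On disconnected graphs, where these numbers are usually left undefined,
   rd and srd take the value given by the same formulas. *)
Definition rd : nat := ex_minn rd_ex.
Definition srd : nat := ex_minn srd_ex.

End Graph.

(* Main.v *)
Require Import Defs.
From mathcomp Require Import all_boot.

(** A rainbow edge-cut in a coloring with at most two colors has at most two
    edges. If it is not minimum, then a minimum edge-cut has at most one edge,
    so it is automatically rainbow. Hence such a coloring is rainbow disconnected
    if and only if it is strong rainbow disconnected. *)

(** Pigeonhole: [c] is injective on a rainbow set. *)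
Lemma rainbow_leq (G : sgraph) (k : nat) (c : {ffun edge G -> 'I_k})
    (F : {set edge G}) : rainbow c F -> #|F| <= k.
Proof.
move=> /forall_inP rF; rewrite -(card_ord k) -(@card_in_imset _ _ c F) ?max_card //.
move=> f g fF gF cfg; apply/eqP; apply: contraT => fg.
by have /forall_inP/(_ g gF)/implyP/(_ fg) := rF f fF; rewrite cfg eqxx.
Qed.

Lemma card_le1_rainbow (G : sgraph) (k : nat) (c : {ffun edge G -> 'I_k})
    (F : {set edge G}) : #|F| <= 1 -> rainbow c F.
Proof.
move=> /card_le1_eqP F1; apply/forall_inP => f fF; apply/forall_inP => g gF.
by rewrite (F1 f g fF gF) eqxx.
Qed.

Lemma strong_rainbow_disconnectedW (G : sgraph) (k : nat)
    (c : {ffun edge G -> 'I_k}) :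
  strong_rainbow_disconnected c -> rainbow_disconnected c.
Proof.
move=> /forallP sc; apply/forallP => u; apply/forallP => v; apply/implyP => uv.
have /forallP/(_ v)/implyP/(_ uv)/existsP[F] := sc u.
by case/andP=> /andP[cF _] rF; apply/existsP; exists F; rewrite cF.
Qed.

Lemma rainbow_disconnected_strong (G : sgraph) (k : nat)
    (c : {ffun edge G -> 'I_k}) :
  k <= 2 -> rainbow_disconnected c -> strong_rainbow_disconnected c.
Proof.
move=> k2 /forallP rc; apply/forallP => u; apply/forallP => v.
apply/implyP => uv.
have /forallP/(_ v)/implyP/(_ uv)/existsP[F /andP[cF rF]] := rc u.
have F2 : #|F| <= 2 by apply: leq_trans k2; apply: rainbow_leq rF.
case: (arg_minnP (fun E : {set edge G} => #|E|) cF) => M cM minM.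
apply/existsP; have [FM | MF] := leqP #|F| #|M|.
  (* Here [F] is no larger than the minimum cut [M], so [F] is itself minimum. *)
  exists F; rewrite /min_edge_cut cF rF andbT.
  by apply/forallP => E; apply/implyP => /minM; apply: (leq_trans FM).
exists M; rewrite /min_edge_cut cM card_le1_rainbow ?andbT; last first.
  by rewrite -ltnS (leq_trans MF).
by apply/forallP => E; apply/implyP => /minM.
Qed.

Lemma rd_leq_srd (G : sgraph) : rd G <= srd G.
Proof.
rewrite /rd /srd; case: ex_minnP => r _ min_r; case: ex_minnP => s + _.
case/existsP=> c sc; apply: min_r; apply/existsP; exists c.
exact: strong_rainbow_disconnectedW.
Qed.

(** An optimal coloring for [rd] has at most two colors, so the same coloring is a candidate for
    [srd]. *)
Lemma srd_leq_rd (G : sgraph) : rd G <= 2 -> srd G <= rd G.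
Proof.
rewrite /rd /srd; case: ex_minnP => r /existsP[c rc] _ r2.
case: ex_minnP => s _; apply; apply/existsP; exists c.
exact: rainbow_disconnected_strong.
Qed.

Theorem theorem2p9 (G : sgraph) (G_nontrivial : nontrivial G)
    (G_connected : connected G) :
  srd G = 2 <-> rd G = 2.
Proof.
have le_rs := rd_leq_srd G; have le_sr := @srd_leq_rd G.
split=> e2; apply/eqP; rewrite eqn_leq.
  (* From [srd G = 2], the inequality [le_rs] gives [rd G <= 2], which is the premise that [le_sr]
     needs to yield [2 <= rd G]. *)
  by move: le_rs le_sr; rewrite e2 => -> ->.
by move: le_rs le_sr; rewrite e2 => -> ->.
Qed.
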